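(* Let $q\ge 2$ and $n\ge 6$ be integers with $n\ge q+3$. (a) If $n-q$ is even, then there exists a $C_q(n)$-polychromatic $2$-coloring of the edges of $K_n$ if and only if $n\ge 3q+3$. (b) If $n-q$ is odd, then there exists a $C_q(n)$-polychromatic $2$-coloring of the edges of $K_n$ if and only if $n\ge 2q+2$.
   Context: $K_n$ is the complete graph on $n$ vertices, and $C_q(n)$ is the family of all cycles in $K_n$ of length precisely $n-q$. A $C_q(n)$-polychromatic $2$-coloring is an edge-coloring of $K_n$ in which exactly two colors are present and every cycle in $C_q(n)$ has edges of both colors. *)

(* Defs.v *)
From mathcomp Require Import all_boot.

Set Implicit Arguments.
Unset Strict Implicit.
Unset Printing Implicit Defensive.

(* Edges of the complete graph on the vertex set 'I_n. *)
Definition edge (n : nat) := {e : {set 'I_n} | #|e| == 2}.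

(* [next s x] is the cyclic successor of x in s, so these are the edges of the
   closed walk s_0 s_1 ... s_(l-1) s_0. *)
Definition cycle_edges (n : nat) (s : seq 'I_n) : {set edge n} :=
  [set e : edge n | [exists x in s, val e == [set x; next s x]]].

(* E is the edge set of a cycle of length l in K_n. *)
Definition is_cycle (n l : nat) (E : {set edge n}) : Prop :=
  exists s : seq 'I_n, [/\ uniq s, size s = l, 3 <= l & E = cycle_edges s].

Definition C_family (q n : nat) (E : {set edge n}) : Prop :=
  is_cycle (n - q) E.

(* F is a family of subgraphs of K_n, each given by its edge set.  The first
   clause says that exactly k colors are present. *)
Definition polychromatic (n k : nat) (F : {set edge n} -> Prop)
    (c : {ffun edge n -> 'I_k}) : Prop :=
  (forall i : 'I_k, exists e : edge n, c e = i) /\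
  (forall E : {set edge n}, F E ->
     forall i : 'I_k, exists2 e : edge n, e \in E & c e = i).

(* Main.v *)
Require Import Defs.
From mathcomp Require Import all_boot zify.

Set Implicit Arguments.
Unset Strict Implicit.
Unset Printing Implicit Defensive.

(** A colouring of the pairs of an n-set by two colours is polychromatic for
    the cycles of length m = n - q exactly when it has no monochromatic cycle
    of length m, so the theorem gives the diagonal Ramsey numbers of cycles
    (Bondy-Erdos, Rosta, Faudree-Schelp): such a colouring exists iff
    n <= 3m/2 - 2 for even m, iff n <= 2m - 2 for odd m, apart from m = 3 and
    m = 4 where the bound is n <= 5.

    Colourings without monochromatic m-cycles: set aside a block of q + 1
    vertices. For even m, colour the pairs that meet the block in one colour and
    the others in the second; a cycle of the first colour is covered by the
    block, hence has at most 2(q + 1) vertices, and the second colour lives on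
    m - 1 vertices. For odd m, colour the pairs between the block and the rest
    in one colour, which is then bipartite, and the others in the second.

    The converse goes by induction in steps of two on the length, the colouring
    being fixed. Let C be a cycle of colour b of length m - 2 (or m - 1), and
    assume that no monochromatic m-cycle exists. For a vertex u off C let R(u)
    be the set of its b-neighbours on C. Inserting one or two vertices off C
    into C would give cycles of forbidden lengths, so no R(u) contains two
    consecutive vertices of C, and for u <> v the sets R(u) and R(v) are
    adjacent along C at most twice, or not at all when uv has colour b.
    Counting along C bounds the union of R(u) and R(v), and leaves about half
    of C as common neighbours of u and v in the other colour. One then runs
    through k, or nearly k, vertices off C (where m = 2k or m = 2k - 1),
    linking consecutive ones either directly by an edge of the other colour or
    through such a common neighbour. The links are chosen greedily
    ([weave_cycle]); mixing direct edges with links adjusts the length and its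
    parity. The count is just sufficient for the greedy choice except for the
    last link or two, and the remaining work is to gain that last unit.

    - Even m, C of length m - 1 ([mono_even_of_pred]). Here the two-vertex
      insertion produces length m + 1, which is excluded since a monochromatic
      (2k + 1)-cycle forces a monochromatic 2k-cycle ([mono_pred]). If the last
      link cannot be gained, all pairs have the same common neighbours, and then
      each u has a private b'-neighbour f(u) (b' the other colour); the f(u)
      are k pairwise non-consecutive vertices on a cycle of length 2k - 1, which
      is impossible.
    - Even m, C of length m - 2 ([mono_even_step]). The pairs off C must all
      have the same colour ([off_cycle_hue]): two adjacent edges of different
      colours give a cycle of length m - 1. If they have the other colour, three
      consecutive direct edges do the same; if they have colour b, a pair with
      an extra common neighbour exists ([three_joined]).
    - Odd m, C of length m - 2 ([mono_odd_step]). Now a single insertion is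
      allowed, and the set I of the insertable vertices is treated apart: all of
      them fit only in the same edge of C. The others, J, again span a single
      colour, and the edges between I and J have colour b up to a star. When I is
      large, an m-cycle of colour b alternates between I and J except for one
      edge of C; otherwise J is large enough to carry most of an m-cycle.

    The induction starts from 3-cycles and 4-cycles on six vertices. *)

(** * Sequences, cycles and counting along a cycle *)

(** Linear arithmetic over the numerical hypotheses alone: the many boolean
    hypotheses on sequences are otherwise all abstracted as propositional atoms,
    on which the decision procedure branches. *)
Ltac arith :=
  repeat match goal with
    H : ?P |- _ =>
      lazymatch P with
      | is_true (leq _ _) => fail
      | is_true (andb (leq _ _) (leq _ _)) => fail
      | is_true (odd _) => fail
      | is_true (negb (odd _)) => fail
      | @eq nat _ _ => fail
      | _ => lazymatch type of P with Prop => clear H end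
      end
  end; lia.

Lemma card_set_seq (T : finType) (s : seq T) :
  uniq s -> #|[set x in s]| = size s.
Proof. by move=> Us; rewrite cardsE; apply/card_uniqP. Qed.

Lemma extend_uniq (T : finType) (A : {set T}) (s : seq T) r :
  uniq s -> {subset s <= A} -> size s + r <= #|A| ->
  exists p, [/\ size p = r, uniq (s ++ p) & {subset p <= A}].
Proof.
move=> Us sA hr; have sz : r <= size (enum (A :\: [set x in s])).
  have := cardsID [set x in s] A; rewrite -cardE.
  have -> : A :&: [set x in s] = [set x in s].
    by apply/setIidPr/subsetP => x; rewrite inE; apply: sA.
  by rewrite (card_set_seq Us); arith.
exists (take r (enum (A :\: [set x in s]))); split.
- by rewrite size_takel.
- rewrite cat_uniq Us take_uniq ?enum_uniq // andbT.
  apply/hasPn => x /mem_take; rewrite mem_enum !inE.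
  by case/andP.
- by move=> x /mem_take; rewrite mem_enum !inE => /andP[].
Qed.

Lemma uniq_path_in (T : eqType) (A : pred T) (r : rel T) x p :
  {in A &, forall u v, u != v -> r u v} -> uniq (x :: p) ->
  {subset x :: p <= A} -> path r x p.
Proof.
move=> rA; elim: p x => //= y p IHp x /andP[xyp Uyp] sA.
have [Ax Ay] : x \in A /\ y \in A by rewrite !sA ?inE ?eqxx ?orbT.
rewrite rA //=; last by move: xyp; rewrite inE negb_or => /andP[].
by apply: IHp => // z zyp; apply: sA; rewrite inE zyp orbT.
Qed.

(** Cycles are taken apart as paths closed at their last vertex; the start of
    such a path is exchanged when a new vertex is spliced in. *)
Lemma path_head (T : Type) (r : rel T) x z p y :
  path r x (rcons p y) -> r z (head y p) -> path r z (rcons p y).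
Proof. by case: p => [|w p] /= => [_ ->|/andP[_ ->] ->]. Qed.

Lemma next_head (T : eqType) (s p : seq T) i x :
  uniq s -> rot i s = x :: p -> next s x = head x p.
Proof.
move=> Us def_s; rewrite -(next_rot i Us) def_s.
by case: p {def_s} => [|y p] /=; rewrite eqxx.
Qed.

Lemma next_neq (T : eqType) (s : seq T) x :
  uniq s -> 1 < size s -> x \in s -> next s x != x.
Proof.
move=> Us ls xs; have [i p def_s] := rot_to xs.
have : uniq (x :: p) by rewrite -def_s rot_uniq.
rewrite (next_head Us def_s); move: ls; rewrite -(size_rot i) def_s.
by case: p {def_s} => //= y p _; rewrite inE negb_or eq_sym => /andP[/andP[]].
Qed.

(** The successor map sends the vertices of [S] with successor outside [S]
    injectively to the complement of [S]; with [a = 0] this says that an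
    independent set takes at most half of a cycle. *)
Lemma adjacent_bound (T : finType) (s : seq T) (S : {set T}) a :
  uniq s -> {subset S <= s} ->
  #|[set x in S | next s x \in S]| <= a -> 2 * #|S| <= size s + a.
Proof.
move=> Us Ss; set A := [set x in S | _] => leA.
have inj_next : injective (next s) := can_inj (prev_next Us).
have : #|next s @: (S :\: A)| <= #|[set x in s] :\: S|.
  apply: subset_leq_card; apply/subsetP => _ /imsetP[x xSA ->].
  by move: xSA; rewrite !inE mem_next negb_and => /andP[/orP[/negP//|->] /Ss].
rewrite card_imset //; have := cardsID A S; have := cardsID S [set x in s].
have -> : [set x in s] :&: S = S.
  by apply/setIidPr/subsetP => x; rewrite inE; apply: Ss.
have -> : S :&: A = A by apply/setIidPr/subsetP => x; rewrite inE => /andP[].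
by rewrite (card_set_seq Us); arith.
Qed.

(** * Monochromatic cycles and the greedy construction *)

Section TwoColourings.

Variables (V : finType) (col : V -> V -> bool).
Hypothesis colC : symmetric col.

(** Both colour classes as relations indexed by the colour, so that a statement
    about [b] also covers the other colour [~~ b]. *)
Definition hue (b : bool) : rel V := fun x y => col x y == b.

Definition mono_cycle m := exists b (s : seq V), [/\ uniq s, size s = m & cycle (hue b) s].

Definition common b (W : {set V}) u v :=
  [set w in W | hue b u w && hue b v w].

Lemma hueC b x y : hue b x y = hue b y x.
Proof. by rewrite /hue colC. Qed.

Lemma hueN b x y : hue (~~ b) x y = ~~ hue b x y.
Proof. by rewrite /hue; case: b; case: (col x y). Qed.

Lemma hue_rcons_rev b x p y :
  path (hue b) x (rcons p y) = path (hue b) y (rcons (rev p) x).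
Proof.
have := rev_path (hue b) x (rcons p y).
rewrite last_rcons belast_rcons rev_cons => ->.
by apply: eq_path => z w; rewrite hueC.
Qed.

Lemma commonC b (W : {set V}) u v : common b W u v = common b W v u.
Proof. by apply/setP => w; rewrite !inE (andbC (hue b u w)). Qed.

Section Weaving.

Variables (b : bool) (W : {set V}).

(** Greedy choice of distinct links for the consecutive pairs of [x :: p],
    avoiding [X]: no pair has fewer common neighbours than there are vertices in
    [X] and links to choose, so one is left whenever a pair is served. *)
Lemma weave_path (X : {set V}) T (x : V) (p : seq V) :
  X \subset W -> size p + #|X| <= T ->
  path (fun u v => T <= #|common b W u v|) x p ->
  exists w q : seq V, [/\ perm_eq q (p ++ w), uniq w & {subset w <= W :\: X}] /\
    [/\ size w = size p, path (hue b) x q & last x q = last x p].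
Proof.
elim: p x X => [|y p IHp] x X sXW hT /=; first by exists [::], [::].
case/andP=> Txy Tp; have [c] : exists c, c \in common b W x y :\: X.
  apply/set0Pn; rewrite -card_gt0; have := cardsID X (common b W x y).
  have : #|common b W x y :&: X| <= #|X| by rewrite subset_leq_card ?subsetIr.
  by move: hT => /=; arith.
rewrite !inE => /and3P[cX cW /andP[xc yc]].
have sX : c |: X \subset W.
  by apply/subsetP=> z; rewrite !inE => /predU1P[-> //|/(subsetP sXW)].
have [|w [q [[qE Uw sw] [sz pq lq]]]] := IHp y _ sX _ Tp.
  by rewrite cardsU1 cX; move: hT => /=; arith.
exists (c :: w), [:: c, y & q]; split; split => //=.
- apply/permP=> a; have /permP/(_ a) := qE; rewrite /= !count_cat /= => ->.
  by rewrite addnCA (addnCA (count a p)).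
- by rewrite Uw andbT; apply/negP => /sw; rewrite !inE eqxx.
- move=> z; rewrite inE => /predU1P[->|/sw]; first by rewrite inE cX.
  by rewrite !inE negb_or -andbA => /and3P[_ -> ->].
- by rewrite sz.
- by rewrite xc hueC yc.
Qed.

(** A closed sequence of vertices off [W] becomes a cycle: the pairs of [x :: d]
    are edges already, the others, including the closing pair, are linked through
    distinct vertices of [W]. The closing pair is served last, so it alone needs
    one more common neighbour than the others. *)
Lemma weave_cycle (x : V) (d p : seq V) :
  uniq (x :: d ++ p) -> {in x :: d ++ p, forall z, z \notin W} ->
  path (hue b) x d ->
  path (fun u v => size p <= #|common b W u v|) (last x d) p ->
  size p < #|common b W (last x (d ++ p)) x| ->
  exists s : seq V, [/\ uniq s, size s = (size d + (size p).*2).+2 & cycle (hue b) s].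
Proof.
move=> Us offW hd hp hcl.
have [||w [q [[qE Uw sw] [sz pq lq]]]] := @weave_path set0 _ _ _ _ _ hp.
- exact: sub0set.
- by rewrite cards0 addn0.
have [c] : exists c, c \in common b W (last x (d ++ p)) x :\: [set z in w].
  apply/set0Pn; rewrite -card_gt0.
  have := cardsID [set z in w] (common b W (last x (d ++ p)) x).
  have : #|common b W (last x (d ++ p)) x :&: [set z in w]| <= size w.
    rewrite -(card_uniqP Uw) -cardsE.
    by apply: subset_leq_card; apply/subsetP => z; rewrite !inE => /andP[].
  by move: hcl; arith.
rewrite !inE => /and3P[cw cW /andP[lc xc]].
have pE : perm_eq (x :: d ++ q ++ [:: c]) ((x :: d ++ p) ++ c :: w).
  apply/permP=> a; have /permP/(_ a) := qE; rewrite /= !count_cat /= => ->.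
  by rewrite addn0 -!addnA (addnC (a c)).
exists (x :: d ++ q ++ [:: c]); split.
- rewrite (perm_uniq pE) cat_uniq Us /= cw Uw !andbT.
  rewrite negb_or; apply/andP; split.
    by apply/negP => /offW; rewrite cW.
  apply/hasPn => z /sw; rewrite inE => /andP[_ zW].
  by apply/negP => /offW; rewrite zW.
- by rewrite (perm_size pE) /= !size_cat /= sz; arith.
- rewrite /= rcons_cat rcons_cat !cat_path hd pq /= lq -last_cat lc.
  by rewrite hueC xc.
Qed.

End Weaving.

(** * Inserting outside vertices into a cycle *)

Section Surgery.

Variables (b : bool) (s : seq V).
Hypotheses (Us : uniq s) (Cs : cycle (hue b) s).

Lemma insert_path x u w : x \in s -> uniq (u :: w) ->
  {in u :: w, forall z, z \notin s} -> path (hue b) x (u :: w) ->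
  hue b (last u w) (next s x) -> mono_cycle (size s + (size w).+1).
Proof.
move=> xs Uw offs pw lw; have [i p def_s] := rot_to xs.
have Up : uniq (x :: p) by rewrite -def_s rot_uniq.
have Cp : cycle (hue b) (x :: p) by rewrite -def_s rot_cycle.
have sp z : z \in x :: p = (z \in s) by rewrite -def_s mem_rot.
exists b, (x :: (u :: w) ++ p); split.
- have -> : uniq (x :: (u :: w) ++ p) = uniq ((u :: w) ++ x :: p).
    by apply: perm_uniq; rewrite -(cat1s x ((u :: w) ++ p)) perm_catCA.
  rewrite cat_uniq Uw Up andbT; apply/hasPn => z; rewrite sp => zs.
  by apply/negP => /offs; rewrite zs.
- by rewrite /= size_cat -(size_rot i s) def_s /=; arith.
- suff : path (hue b) x ((u :: w) ++ rcons p x) by rewrite /= rcons_cat.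
  rewrite cat_path pw; apply: (path_head Cp).
  by rewrite -(next_head Us def_s).
Qed.

(** Two vertices joined by an edge replace the successor of [x]. *)
Lemma insert_skip x u v : x \in s -> 2 < size s -> u != v ->
  u \notin s -> v \notin s -> hue b x u -> hue b u v ->
  hue b v (next s (next s x)) -> mono_cycle (size s).+1.
Proof.
move=> xs ls nuv us vs xu uv vnn; have [i p def_s] := rot_to xs.
have Up : uniq (x :: p) by rewrite -def_s rot_uniq.
have Cp : cycle (hue b) (x :: p) by rewrite -def_s rot_cycle.
have sp z : z \in x :: p = (z \in s) by rewrite -def_s mem_rot.
have := size_rot i s; rewrite def_s.
case: p => [|y p] in def_s Up Cp sp * => [/= sz|sz]; first by arith.
have r1 : rot 1 (rot i s) = y :: rcons p x by rewrite def_s rot1_cons.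
have nx : next s x = y by rewrite (next_head Us def_s).
have ny : next s y = head x p.
  by rewrite -(next_rot i Us) (next_head _ r1) ?rot_uniq //; case: (p).
exists b, [:: x, u, v & p]; split.
- move: Up us vs; rewrite -!sp !inE !negb_or /=.
  case/and3P; rewrite inE negb_or => /andP[_ xp] yp -> /and3P[ux _ up].
  case/and3P=> vx _ vp.
  by rewrite !inE !negb_or xp nuv up vp (eq_sym x) ux (eq_sym x) vx.
- by move: sz => /=; arith.
- rewrite /= xu uv /=; move: Cp => /= /andP[_ Cp].
  by apply: (path_head Cp); rewrite -ny -nx.
Qed.

Lemma insert_two x y u v : x \in s -> y \in s -> x != y ->
  u \notin s -> v \notin s -> u != v ->
  hue b u x -> hue b u (next s x) -> hue b v y -> hue b v (next s y) ->
  mono_cycle (size s).+2.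
Proof.
move=> xs ys nxy us vs nuv ux unx vy vny.
have [i p q _ _ def_s] := rot_to_arc Us xs ys nxy.
have Up : uniq (x :: p ++ y :: q) by rewrite -def_s rot_uniq.
have Cp : cycle (hue b) (x :: p ++ y :: q) by rewrite -def_s rot_cycle.
have sp z : z \in x :: p ++ y :: q = (z \in s) by rewrite -def_s mem_rot.
have nx : next s x = head y p by rewrite (next_head Us def_s); case: (p).
have ny : next s y = head x q.
  have r : rot (size (x :: p)) (rot i s) = y :: q ++ x :: p.
    by rewrite def_s -cat_cons rot_size_cat.
  by rewrite -(next_rot i Us) (next_head _ r) ?rot_uniq //; case: (q).
have pE : perm_eq (x :: u :: p ++ y :: v :: q) ([:: u; v] ++ x :: p ++ y :: q).
  by apply/permP=> a /=; rewrite !count_cat /=; arith.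
exists b, (x :: u :: p ++ y :: v :: q); split.
- rewrite (perm_uniq pE) cat_uniq Up andbT; apply/andP; split.
    by rewrite /= inE nuv.
  apply/hasPn => z; rewrite sp => zs; rewrite !inE negb_or.
  by apply/andP; split; apply: contraTneq zs => ->.
- by rewrite (perm_size pE) -(size_rot i s) def_s.
- move: Cp; rewrite /= !rcons_cat /= -cat_rcons cat_path last_rcons.
  case/andP=> Cp Cq; rewrite (hueC b x) ux -cat_rcons cat_path last_rcons /=.
  by rewrite (path_head Cp) -?nx // (hueC b y) vy (path_head Cq) // -ny.
Qed.

(** With [x'] and [y'] the successors of [x] and [y], the new cycle is
    [x, u, y], back along the cycle to [x'], then [v], [y'] and on to [x]. *)
Lemma insert_cross x y u v : x \in s -> y \in s -> x != y ->
  u \notin s -> v \notin s -> u != v ->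
  hue b u x -> hue b v (next s x) -> hue b u y -> hue b v (next s y) ->
  mono_cycle (size s).+2.
Proof.
move=> xs ys nxy us vs nuv ux vnx uy vny.
have [i p q _ _ def_s] := rot_to_arc Us xs ys nxy.
have Up : uniq (x :: p ++ y :: q) by rewrite -def_s rot_uniq.
have Cp : cycle (hue b) (x :: p ++ y :: q) by rewrite -def_s rot_cycle.
have sp z : z \in x :: p ++ y :: q = (z \in s) by rewrite -def_s mem_rot.
have nx : next s x = head y p by rewrite (next_head Us def_s); case: (p).
have ny : next s y = head x q.
  have r : rot (size (x :: p)) (rot i s) = y :: q ++ x :: p.
    by rewrite def_s -cat_cons rot_size_cat.
  by rewrite -(next_rot i Us) (next_head _ r) ?rot_uniq //; case: (q).
have pE : perm_eq (x :: u :: y :: rev p ++ v :: q)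
                  ([:: u; v] ++ x :: p ++ y :: q).
  by apply/permP=> a /=; rewrite !count_cat /= count_rev; arith.
exists b, (x :: u :: y :: rev p ++ v :: q); split.
- rewrite (perm_uniq pE) cat_uniq Up andbT; apply/andP; split.
    by rewrite /= inE nuv.
  apply/hasPn => z; rewrite sp => zs; rewrite !inE negb_or.
  by apply/andP; split; apply: contraTneq zs => ->.
- by rewrite (perm_size pE) -(size_rot i s) def_s.
- move: Cp; rewrite /= !rcons_cat /= -cat_rcons cat_path last_rcons.
  case/andP=> Cp Cq; rewrite (hueC b x) ux uy -cat_rcons cat_path last_rcons /=.
  rewrite (path_head Cq) -?ny // andbT -hue_rcons_rev.
  by apply: (path_head Cp); rewrite -nx.
Qed.

End Surgery.

(** * Common neighbours in the other colour *)

Section Common.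

Variables (b : bool) (s : seq V).
Hypotheses (Us : uniq s) (Cs : cycle (hue b) s).

Let ends := common (~~ b) [set x in s].

Definition touched u v := [set x in s | hue b u x || hue b v x].

Definition insertable u := [exists x in s, hue b u x && hue b u (next s x)].

Lemma insertableN u x :
  ~~ insertable u -> x \in s -> hue b u x -> hue b u (next s x) = false.
Proof.
move/existsPn/(_ x); rewrite negb_and => /orP[/negPf -> //|].
by rewrite negb_and => /orP[/negPf -> //|/negPf].
Qed.

Lemma card_reach u v : #|touched u v| + #|ends u v| = size s.
Proof.
have rs : {subset touched u v <= s} by move=> x; rewrite inE => /andP[].
rewrite -(card_set_seq Us) -(cardsID (touched u v) [set x in s]).
congr (_ + _); apply: eq_card => x; rewrite !inE; first by case: (x \in s).
by rewrite !hueN -negb_or; case: (x \in s); rewrite ?andbT.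
Qed.

(** The common neighbours of [u] and [v] in the other colour are the vertices of
    [s] outside [touched u v], so a bound on the adjacencies in the latter bounds
    their number from below. *)
Lemma common_bound u v a :
  #|[set x in touched u v | next s x \in touched u v]| <= a ->
  size s <= 2 * #|ends u v| + a.
Proof.
move=> lea; have rs : {subset touched u v <= s} by move=> x; rewrite inE => /andP[].
by have := adjacent_bound Us rs lea; have := card_reach u v; arith.
Qed.

Lemma common_free u v :
  {in s, forall x, hue b u x || hue b v x ->
    ~~ (hue b u (next s x) || hue b v (next s x))} ->
  size s <= 2 * #|ends u v|.
Proof.
move=> free; rewrite -[2 * _]addn0; apply: common_bound.
rewrite leqn0 cards_eq0 -subset0; apply/subsetP => x.
by rewrite !inE mem_next => /andP[/andP[xs /(free _ xs)/negPf->]]; rewrite andbF.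
Qed.

Lemma common_self u : ~~ insertable u -> size s <= 2 * #|ends u u|.
Proof.
move=> nu; apply: common_free => x xs; rewrite !orbb => ux.
by rewrite (insertableN nu).
Qed.

Hypothesis no2 : ~ mono_cycle (size s).+2.

Section Pair.

Variables u v : V.
Hypotheses (us : u \notin s) (vs : v \notin s) (nuv : u != v).
Hypotheses (nu : ~~ insertable u) (nv : ~~ insertable v).

(** An adjacency in [touched u v] leads from a neighbour of one of [u] and [v] to
    a neighbour of the other one, and two adjacencies in the same direction
    would allow [insert_cross]. *)
Lemma common_cross : size s <= 2 * #|ends u v| + 2.
Proof.
pose cr w z := [set x in s | hue b w x && hue b z (next s x)].
have le1 w z : w != z -> w \notin s -> z \notin s -> #|cr w z| <= 1.
  move=> nwz ws zs; apply/card_le1_eqP => x y.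
  rewrite !inE => /and3P[xs wx znx] /and3P[ys wy zny].
  apply/eqP/negPn/negP => nxy; apply: no2.
  exact: (insert_cross Us Cs ys xs nxy ws zs nwz wy zny wx znx).
apply: common_bound; apply: (@leq_trans #|cr u v :|: cr v u|).
  apply: subset_leq_card; apply/subsetP => x.
  rewrite !inE mem_next => /andP[/andP[xs uvx]]; rewrite xs /=.
  case/orP: uvx => wx; first by rewrite wx (insertableN nu) //= => ->.
  by rewrite wx (insertableN nv) //= orbF => ->; rewrite orbT.
rewrite cardsU; have := le1 u v nuv us vs.
have := le1 v u; rewrite eq_sym => /(_ nuv vs us).
by arith.
Qed.

(** Here [u] and [v] could be inserted together at any adjacency. *)
Lemma common_joined : hue b u v -> size s <= 2 * #|ends u v|.
Proof.
move=> uv; apply: common_free => x xs uvx; apply/negP => uvnx; apply: no2.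
have ins w z : w != z -> w \notin s -> z \notin s -> hue b w z ->
    hue b w x -> hue b z (next s x) -> mono_cycle (size s).+2.
  move=> nwz ws zs wz wx znx.
  have := @insert_path b s Us Cs x w [:: z] xs; rewrite /= addn2; apply => //.
  - by rewrite inE nwz.
  - by move=> y; rewrite !inE => /orP[] /eqP->.
  - by rewrite hueC wx wz.
case/orP: uvx => wx; case/orP: uvnx => wnx.
- by rewrite (insertableN nu) in wnx.
- exact: (ins u v).
- by apply: (ins v u) => //; rewrite 1?eq_sym 1?hueC.
- by rewrite (insertableN nv) in wnx.
Qed.

End Pair.

End Common.

(** * Shortening an odd cycle by one *)

Section Labelling.

(** A cycle of length [L] seen as an [L]-periodic map on the natural numbers, which
    makes rotations and the passage to steps of length two plain arithmetic. *)
Definition labelling b L (g : nat -> V) :=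
  [/\ forall i, g (i + L) = g i, forall i j, g i = g j -> i = j %[mod L]
    & forall i, hue b (g i) (g i.+1)].

Lemma cycle_labelling b (s : seq V) :
  uniq s -> cycle (hue b) s -> 0 < size s -> exists g, labelling b (size s) g.
Proof.
case: s => // x p Us Cs _; set L := size _.
have ltL i : i %% L < L by rewrite ltn_mod.
exists (fun i => nth x (x :: p) (i %% L)); split.
- by move=> i; rewrite modnDr.
- by move=> i j /eqP; rewrite nth_uniq // => /eqP.
- move=> i; have /pathP/(_ (i %% L)) := Cs => /(_ x); rewrite size_rcons ltL.
  move=> /(_ isT); rewrite -rcons_cons nth_rcons ltL => h.
  suff -> : nth x (x :: p) (i.+1 %% L) = nth x (rcons p x) (i %% L) by [].
  rewrite nth_rcons -(addn1 i) -modnDml addn1; have := ltL i.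
  rewrite {1}/L /= ltnS leq_eqVlt => /predU1P[->|lt].
    by rewrite modnn ltnn eqxx.
  by rewrite lt modn_small.
Qed.

Lemma last_iota x n : last x (iota x.+1 n) = x + n.
Proof. by elim: n x => [|n IHn] x /=; rewrite ?addn0 // IHn; arith. Qed.

Lemma label_path b L g x n : labelling b L g ->
  path (hue b) (g x) (map g (iota x.+1 n)).
Proof. by case=> _ _ gS; elim: n x => //= n IHn x; rewrite gS IHn. Qed.

(** The cycle [i, i + d, i + d - 1, ..., i + 2, i + d + 1, ..., i + L - 1] omits
    only [i + 1]. *)
Lemma skip_one b L g i d : labelling b L g -> 1 < d -> d + 2 <= L ->
  hue b (g i) (g (i + d)) -> hue b (g (i + 2)) (g (i + d + 1)) -> mono_cycle L.-1.
Proof.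
move=> lab; have [gL gI gS] := lab; case: d => [//|[//|e]] _ leL c1 c2.
pose t := i :: rev (iota (i + 2) e.+1) ++ iota (i + e + 3) (L - e - 3).
have mem_t z : z \in t -> i <= z < i + L.
  by rewrite inE mem_cat mem_rev !mem_iota; arith.
have Ut : uniq t.
  rewrite /t cons_uniq cat_uniq rev_uniq !iota_uniq andbT.
  rewrite mem_cat mem_rev !mem_iota; apply/andP; split; first by arith.
  apply/hasPn => z zQ; apply/negP => zP.
  have {zP} : z \in rev (iota (i + 2) e.+1) by [].
  by move: zQ; rewrite mem_rev !mem_iota; arith.
exists b, (map g t); split.
- rewrite map_inj_in_uniq // => x y /mem_t hx /mem_t hy /gI exy.
  wlog le_xy : x y hx hy exy / x <= y.
    by move=> w; case: (leqP x y) => [|/ltnW] h; [apply: w | apply/esym/w].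
  move/esym/eqP: exy; rewrite eqn_mod_dvd // => dv.
  by case: (posnP (y - x)) => [|/dvdn_leq/(_ dv)]; arith.
- by rewrite size_map /t -cat1s !size_cat size_rev !size_iota [size _]/=; arith.
- rewrite [map g t]/= -cat1s map_cat map_rev /=.
  rewrite rcons_cat rev_cons cat_path.
  rewrite last_rcons hue_rcons_rev revK rcons_path.
  have -> : i + 2 = (i + 1).+1 by arith.
  rewrite (label_path _ _ lab) /= last_map last_iota hueC.
  have -> : (i + 1).+1 + e = i + e.+2 by arith.
  rewrite c1 /= -(gL i); have -> : g (i + L) = g (i + e + 3 + (L - e - 3)).
    by congr g; arith.
  rewrite -map_rcons.
  have -> : rcons (iota (i + e + 3) (L - e - 3)) (i + e + 3 + (L - e - 3)) =
            iota (i + e + 3) (L - e - 3).+1.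
    by rewrite -(addn1 (L - e - 3)) iotaD cats1.
  rewrite /= (label_path _ _ lab) andbT.
  by move: c2; rewrite !addn2 !addn1 (_ : i + e + 3 = (i + e.+2).+1) //; arith.
Qed.

Lemma no_short_chord b L g i : 3 < L -> ~ mono_cycle L.-1 -> labelling b L g ->
  hue (~~ b) (g i) (g (i + 2)).
Proof.
move=> leL noL lab; rewrite hueN; apply/negP => c; apply: noL.
apply: (skip_one (i := i) (d := 2) lab) => //.
by case: lab => _ _ /(_ (i + 2)); rewrite addn1.
Qed.

(** Suppose no monochromatic cycle has length [2k]. By [skip_one], the chords of
    length 2 of a cycle of colour [b] and length [L = 2k + 1] have the other
    colour. As [L] is odd they form a cycle [h] again, whose chords of length 2,
    the chords of length 4 of the given cycle, have colour [b]. By [skip_one]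
    once more the chords of length 3 have the other colour, and a chord of
    length 5 can have neither colour: [b] is excluded by the chords of length 4,
    the other one by those of length 3, which are long chords of [h]. *)
Lemma mono_pred k : 2 < k -> ~ mono_cycle (2 * k) -> ~ mono_cycle (2 * k).+1.
Proof.
move=> k3 noL [b [s [Us sz Cs]]].
have [|f] := cycle_labelling Us Cs; rewrite sz //.
set L := (2 * k).+1 => lab; have [fL fI fS] := lab.
have fLn n i : f (i + n * L) = f i.
  by elim: n => [|n IHn]; rewrite ?addn0 // mulSn addnCA addnC fL.
pose h j := f (2 * j).
(* Even labels stand for all of them: [i] and [2 * (i * k.+1)] agree modulo [L]. *)
have hE i j n : 2 * j = i + n * L -> h j = f i by rewrite /h => ->.
have labN : labelling (~~ b) L h.
  split=> [i|i j /fI eij|i]; first by rewrite (hE (2 * i) _ 2) //; arith.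
  - have kK z : (k.+1 * (2 * z)) %% L = z %% L.
      by rewrite (_ : _ * _ = z * L + z) ?modnMDl // /L; arith.
    by rewrite -(kK i) -(kK j) -modnMmr eij modnMmr.
  - rewrite (_ : h i.+1 = f (2 * i + 2)); last by congr f; arith.
    by apply: no_short_chord lab; rewrite // /L; arith.
have c4 i : hue b (f i) (f (i + 4)).
  rewrite -(hE i (i * k.+1) i) -1?(hE (i + 4) (i * k.+1 + 2) i); try (rewrite /L; arith).
  by rewrite -[b]negbK; apply: no_short_chord labN; rewrite // /L; arith.
have c3 i : hue (~~ b) (f i) (f (i + 3)).
  rewrite hueN; apply/negP => c; apply: noL.
  apply: (skip_one (i := i + L - 2) (d := 4) lab) => //; first by rewrite /L; arith.
  rewrite (_ : i + L - 2 + 2 = i + L) 1?(_ : i + L - 2 + 4 + 1 = i + 3 + L) ?fL //.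
    by rewrite /L; arith.
  by rewrite /L; arith.
(* For [L = 7], lengths 3 and 4 are the same. *)
have [k_eq3|k4] : k = 3 \/ 3 < k by arith.
  have := c3 4; have := c4 0; rewrite hueN.
  by rewrite (_ : 4 + 3 = 0 + L) ?fL 1?hueC => [-> //|]; rewrite /L; arith.
case: (boolP (hue b (f 0) (f 5))) => c; apply: noL.
  by apply: (skip_one (i := 0) (d := 5) lab (isT : 1 < 5) _ c (c4 2)); arith.
(* In [h], the chord [k + 1, 2k] is the chord [1, L - 2], of length 3, and
   [k + 3, 2k + 1] is the chord [5, 0]. *)
apply: (skip_one (i := k.+1) (d := k.-1) labN); try (rewrite /L; arith).
- rewrite (hE 1 k.+1 1) 1?(hE (L - 2) (k.+1 + k.-1) 1); try (rewrite /L; arith).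
  rewrite hueC; have := c3 (L - 2).
  by rewrite (_ : L - 2 + 3 = 1 + L) ?fL // /L; arith.
- rewrite (hE 5 (k.+1 + 2) 1) 1?(hE 0 (k.+1 + k.-1 + 1) 2); try (rewrite /L; arith).
  by rewrite hueC hueN.
Qed.

End Labelling.

(** * Triangles and quadrilaterals on six vertices *)

Section SixVertices.

(** Reduces the search for a monochromatic cycle among finitely many named
    vertices, given by their indices, to a boolean case analysis. *)
Lemma mono_among m b v (vs : seq V) (qs : seq (seq nat)) : uniq vs ->
  all (fun q => [&& uniq q, size q == m & all (gtn (size vs)) q]) qs ->
  has (fun q => let p := map (nth v vs) q in
         cycle (hue b) p || cycle (hue (~~ b)) p) qs ->
  mono_cycle m.
Proof.
move=> Uvs /allP okqs /hasP[q /okqs /and3P[Uq /eqP szq /allP ltq] Cq].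
have Up : uniq (map (nth v vs) q).
  rewrite map_inj_in_uniq // => i j /ltq lti /ltq ltj /eqP.
  by rewrite nth_uniq // => /eqP.
by case/orP: Cq => Cq; [exists b | exists (~~ b)]; exists (map (nth v vs) q);
  rewrite size_map.
Qed.

Lemma three_alike : 6 <= #|V| -> exists b v x y z t w,
  uniq [:: v; x; y; z; t; w] /\ [/\ hue b v x, hue b v y & hue b v z].
Proof.
move=> V6; have /set0Pn[v _] : [set: V] != set0 by rewrite -card_gt0 cardsT; arith.
pose N b := [set x | (x != v) && hue b v x].
have [b Nb] : exists b, 3 <= #|N b|.
  have : #|N true| + #|N false| = #|[set~ v]|.
    rewrite -(cardsID (N true) [set~ v]); congr (_ + _); apply: eq_card => x.
      by rewrite !inE; case: (x == v); rewrite ?andbF.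
    by rewrite !inE /hue; case: (x == v); case: (col v x).
  rewrite cardsC1; case: (leqP 3 #|N true|) => [|lt3 e]; first by exists true.
  by exists false; move: e; arith.
have [//|//|p [szp Up Np]] := @extend_uniq V (N b) [::] 3 _ _ Nb.
have Uvp : uniq (v :: p) by rewrite /= Up andbT; apply/negP => /Np; rewrite !inE eqxx.
have [||q [szq Uq _]] := @extend_uniq V setT (v :: p) 2 Uvp.
- by move=> x _; rewrite inE.
- by rewrite cardsT /= szp.
case: p szp Np Uq {Up Uvp} => [|x [|y [|z []]]] // _ Np.
case: q szq => [|t [|w []]] // _ Uq.
exists b, v, x, y, z, t, w; split=> //.
by split; [have := Np x | have := Np y | have := Np z]; rewrite !inE eqxx ?orbT;
  case/(_ isT)/andP.
Qed.

Lemma mono_triangle : 6 <= #|V| -> mono_cycle 3.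
Proof.
case/three_alike=> b [v [x [y [z [t [w [U [vx vy vz]]]]]]]].
apply: (@mono_among 3 b v _
  [:: [:: 0; 1; 2]; [:: 0; 1; 3]; [:: 0; 2; 3]; [:: 1; 2; 3]] U) => //.
rewrite /= !hueN ?(hueC b x v) ?(hueC b y v) ?(hueC b z v) ?(hueC b z x) ?(hueC b z y)
  vx vy vz.
by case: (hue b x y); case: (hue b x z); case: (hue b y z).
Qed.

(** With [v] joined to [x], [y], [z] in colour [b], the colours of the other ten
    pairs among [x], [y], [z], [t], [w] already force a cycle. *)
Lemma mono_quadrilateral : 6 <= #|V| -> mono_cycle 4.
Proof.
case/three_alike=> b [v [x [y [z [t [w [U [vx vy vz]]]]]]]].
apply: (@mono_among 4 b v _
  [:: [:: 0; 1; 4; 2]; [:: 0; 1; 4; 3]; [:: 0; 2; 4; 3];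
      [:: 0; 1; 5; 2]; [:: 0; 1; 5; 3]; [:: 0; 2; 5; 3];
      [:: 1; 4; 2; 5]; [:: 1; 4; 3; 5]; [:: 2; 4; 3; 5];
      [:: 0; 1; 2; 3]; [:: 0; 2; 3; 1]; [:: 0; 3; 1; 2];
      [:: 1; 2; 3; 4]; [:: 1; 2; 4; 3]; [:: 1; 4; 2; 3];
      [:: 1; 2; 3; 5]; [:: 1; 2; 5; 3]; [:: 1; 5; 2; 3];
      [:: 1; 2; 4; 5]; [:: 1; 2; 5; 4]; [:: 1; 3; 4; 5]; [:: 1; 3; 5; 4];
      [:: 2; 3; 4; 5]; [:: 2; 3; 5; 4]] U) => //.
rewrite /= !hueN ?(hueC b x v) ?(hueC b y v) ?(hueC b z v) ?(hueC b y x).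
rewrite ?(hueC b z x) ?(hueC b t x) ?(hueC b w x) ?(hueC b z y) ?(hueC b t y).
rewrite ?(hueC b w y) ?(hueC b t z) ?(hueC b w z) ?(hueC b w t) vx vy vz /=.
case: (hue b x t); case: (hue b y t); case: (hue b z t) => //=;
case: (hue b x w); case: (hue b y w); case: (hue b z w) => //=;
case: (hue b x y); case: (hue b y z); case: (hue b x z) => //=;
by case: (hue b t w).
Qed.

End SixVertices.

(** * Weaving inside a set of vertices *)

Section WeaveIn.

Variables (c : bool) (W J : {set V}).
Hypothesis offJ : {in J, forall z, z \notin W}.

(** The sequence is [x :: d], then [r] arbitrary vertices, then [z], so that the
    exceptional closing pair can be prescribed to be [z, x]. *)
Lemma weave_last r x (d : seq V) z m :
  {in J &, forall u v, u != v -> r < #|common c W u v|} ->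
  uniq (x :: rcons d z) -> {subset x :: rcons d z <= J} -> path (hue c) x d ->
  r.+1 < #|common c W z x| -> size d + r.+2 <= #|J| ->
  m = size d + r.*2 + 4 -> mono_cycle m.
Proof.
move=> big Us sJ hd hcl leJ ->.
have [|q [szq Uq qJ]] := @extend_uniq _ J (x :: rcons d z) r Us sJ.
  by rewrite /= size_rcons; arith.
have pE : perm_eq (x :: d ++ rcons q z) ((x :: rcons d z) ++ q).
  by rewrite /= perm_cons cat_rcons perm_cat2l -cats1 perm_catC.
have allJ : {subset x :: d ++ rcons q z <= J}.
  by move=> y; rewrite (perm_mem pE) mem_cat => /orP[/sJ|/qJ].
have Up : uniq (x :: d ++ rcons q z) by rewrite (perm_uniq pE).
have [||//||s [Us' szs Cs]] := @weave_cycle c W x d (rcons q z) Up.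
- by move=> y /allJ/offJ.
- exact: hd.
- rewrite size_rcons szq; apply: (@uniq_path_in _ (mem J)) big _ _.
    by move: Up; rewrite -cat_cons (lastI x d) cat_rcons cat_uniq => /and3P[].
  move=> y yp; apply: allJ; rewrite -cat_cons (lastI x d) cat_rcons mem_cat yp.
  by rewrite orbT.
- by rewrite size_rcons szq last_cat last_rcons.
by exists c, s; split=> //; rewrite szs size_rcons szq; arith.
Qed.

(** The closing pair is arbitrary here: one unit more is asked of every pair. *)
Lemma weave_any r x (d : seq V) m :
  {in J &, forall u v, u != v -> r < #|common c W u v|} ->
  uniq (x :: d) -> {subset x :: d <= J} -> path (hue c) x d ->
  0 < size d + r -> size d + r.+1 <= #|J| ->
  m = size d + r.*2 + 2 -> mono_cycle m.
Proof.
move=> big Us sJ hd pos leJ ->.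
have [|q [szq Uq qJ]] := @extend_uniq _ J (x :: d) r Us sJ.
  by rewrite /=; arith.
have allJ : {subset x :: d ++ q <= J}.
  by move=> y; rewrite -cat_cons mem_cat => /orP[/sJ|/qJ].
have [||//||s [Us' szs Cs]] := @weave_cycle c W x d q Uq.
- by move=> y /allJ/offJ.
- exact: hd.
- rewrite szq; apply: (@uniq_path_in _ (mem J)).
  + by move=> u v uJ vJ nuv; apply/ltnW/big.
  + by move: Uq; rewrite (lastI x d) cat_rcons cat_uniq => /and3P[].
  move=> y yp; apply: allJ; rewrite -cat_cons (lastI x d) cat_rcons mem_cat yp.
  by rewrite orbT.
- rewrite szq; apply: big; try by apply: allJ; rewrite ?mem_head ?mem_last.
  case: (d ++ q) (Uq : uniq (x :: d ++ q)) (size_cat d q) => [|y p] /=; first by rewrite szq; arith.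
  by case/andP=> xyp _ _; apply: contraNneq xyp => /= e; rewrite -{1}e mem_last.
by exists c, s; split=> //; rewrite szs szq; arith.
Qed.

End WeaveIn.

(** If both colours occur in [J], then they occur at a common vertex. *)
Lemma two_hues (J : {set V}) :
  (exists c, {in J &, forall u v, u != v -> hue c u v}) \/
  forall b, exists u x y, [/\ u \in J, x \in J, y \in J & uniq [:: u; x; y]] /\
    (hue (~~ b) u x /\ hue b u y).
Proof.
pose clique c := [forall u in J, forall v in J, (u != v) ==> hue c u v].
have cliqueP c : clique c -> exists c, {in J &, forall u v, u != v -> hue c u v}.
  move=> /forall_inP hc; exists c => u v uJ vJ nuv.
  by have /forall_inP/(_ _ vJ)/implyP := hc _ uJ; apply.
case: (boolP (clique true)) => [/cliqueP|]; first by left.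
case: (boolP (clique false)) => [/cliqueP|]; first by left.
rewrite !negb_forall => /existsP[x]; rewrite negb_imply => /andP[xJ].
rewrite negb_forall => /existsP[x']; rewrite !negb_imply => /and3P[x'J nx xx'].
case/existsP=> y; rewrite negb_imply => /andP[yJ].
rewrite negb_forall => /existsP[y']; rewrite !negb_imply => /and3P[y'J ny yy'].
rewrite -hueN /= in xx'; rewrite -hueN /= in yy'; right=> b.
suff [u [z [t [[uJ zJ tJ] [Uu uz ut]]]]] : exists u z t,
    [/\ u \in J, z \in J & t \in J] /\
    [/\ uniq [:: u; z; t], hue true u z & hue false u t].
  case: b; exists u; [exists t, z | exists z, t]; do !split=> //.
  by move: Uu; rewrite /= !inE !negb_or (eq_sym t) (andbC (u != z)).
have neq u z t : hue true u z -> hue false u t -> z != t.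
  by move=> uz; apply: contraTneq => <-; rewrite (hueN true) uz.
have pack u z t : u \in J -> z \in J -> t \in J -> u != z -> u != t ->
    hue true u z -> hue false u t -> exists u z t, [/\ u \in J, z \in J & t \in J] /\
    [/\ uniq [:: u; z; t], hue true u z & hue false u t].
  move=> uJ zJ tJ nuz nut uz ut; exists u, z, t; split; split=> //.
  by rewrite /= !inE negb_or nuz nut (neq u).
have [eyx|nyx] := eqVneq y x; first by apply: (pack x x' y') => //; rewrite -eyx.
case: (boolP (hue true x y)) => xy.
  by apply: (pack y x y'); rewrite // hueC.
by apply: (pack x x' y); rewrite // 1?eq_sym // (hueN true).
Qed.
(** Monochromatic cycles range over a finite set, so reasoning by contradiction
    on their existence is constructive. *)
Lemma mono_dec m : mono_cycle m \/ ~ mono_cycle m.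
Proof.
pose P := [exists b : bool, exists t : m.-tuple V, uniq t && cycle (hue b) t].
case: (boolP P) => [/existsP[b /existsP[t /andP[Ut Ct]]]|nP]; [left | right].
  by exists b, t; rewrite size_tuple.
case=> b [s [Us sz Cs]]; case/existsP: nP; exists b; apply/existsP.
by exists (tcast sz (in_tuple s)); rewrite val_tcast Us.
Qed.

(** * Vertices off a monochromatic cycle *)

Section OffCycle.

Variables (b : bool) (s : seq V).
Hypotheses (Us : uniq s) (Cs : cycle (hue b) s).

Let W := [set x in s].

Lemma not_insertable u :
  ~ mono_cycle (size s).+1 -> u \notin s -> ~~ insertable b s u.
Proof.
move=> no1 us; apply/negP => /existsP[x /andP[xs /andP[ux unx]]]; apply: no1.
have := @insert_path b s Us Cs x u [::] xs; rewrite addn1; apply=> //=.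
  by move=> z; rewrite inE => /eqP->.
by rewrite hueC ux.
Qed.

(** Three consecutive direct edges followed by [t] links. *)
Lemma weave_clique t (J : {set V}) :
  {in J, forall z, z \notin s} -> 0 < t -> t + 3 <= #|J| ->
  {in J &, forall u v, u != v -> t <= #|common (~~ b) W u v|} ->
  {in J &, forall u v, u != v -> hue (~~ b) u v} -> mono_cycle (2 * t + 3).
Proof.
move=> offJ t_gt0 leJ big cliqueJ.
have [//|//||p [szp Up pJ]] := @extend_uniq V J [::] 4; first by move: leJ => /=; arith.
case: p szp Up pJ => [|x d] //= [szd] Up pJ.
apply: (@weave_any (~~ b) W J _ t.-1 x d) => //.
- by move=> z /offJ; rewrite inE.
- by move=> u v uJ vJ nuv; have := big _ _ uJ vJ nuv; arith.
- by apply: (@uniq_path_in _ (mem J)) cliqueJ Up pJ.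
- by rewrite szd.
- by rewrite szd; arith.
- by rewrite szd; arith.
Qed.

(** If [u x] has the other colour and [u y] has colour [b], then [x, u] is used
    as a direct edge, and the pair [y, u], which has one common neighbour more
    because it has colour [b], closes the cycle. *)
Lemma off_cycle_hue t (J : {set V}) :
  {in J, forall z, z \notin s} -> {in J, forall z, ~~ insertable b s z} ->
  ~ mono_cycle (size s).+2 -> ~ mono_cycle (2 * t + 3) -> 0 < t -> 2 * t < size s ->
  t + 2 <= #|J| -> exists c, {in J &, forall u v, u != v -> hue c u v}.
Proof.
move=> offJ insJ no2 noL t_gt0 ltt leJ.
case: (two_hues J) => // /(_ b) [u [x [y [[uJ xJ yJ Uuxy] [ux uy]]]]].
case: noL; apply: (@weave_last (~~ b) W J _ t.-1 u [:: x] y) => //=.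
- by move=> z /offJ; rewrite inE.
- move=> z w zJ wJ nzw.
  have := common_cross Us Cs no2 (offJ _ zJ) (offJ _ wJ) nzw (insJ _ zJ) (insJ _ wJ).
  by rewrite -/W; arith.
- by move=> z; rewrite !inE => /or3P[] /eqP->.
- by rewrite ux.
- move: Uuxy; rewrite /= !inE negb_or => /andP[/andP[_ nuy] _].
  rewrite eq_sym in nuy.
  have := common_joined Us Cs no2 (offJ _ yJ) (offJ _ uJ) nuy (insJ _ yJ) (insJ _ uJ).
  by rewrite hueC uy => /(_ isT); rewrite -/W; arith.
- by arith.
- by arith.
Qed.

(** Otherwise each pair among [u], [v], [w] touches the same half [S] of the
    cycle, every second vertex. Each vertex of [S] is then a neighbour of two of
    the three. So if [z] is in [S], there are distinct [x] and [y] among the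
    three joined to [z] and to the second successor of [z], and [x, y] can
    replace the first successor of [z]. *)
Lemma three_joined u v w :
  uniq [:: u; v; w] -> {in [:: u; v; w], forall z, z \notin s} ->
  {in [:: u; v; w] &, forall x y, x != y -> hue b x y} -> 2 < size s ->
  ~ mono_cycle (size s).+1 -> ~ mono_cycle (size s).+2 ->
  exists x y, [/\ x \in [:: u; v; w], y \in [:: u; v; w], x != y &
                size s < 2 * #|common (~~ b) W x y|].
Proof.
move=> Uuvw off cl ls no1 no2; pose D := [:: u; v; w].
case: (boolP [exists x in D, exists y in D,
         (x != y) && (size s < 2 * #|common (~~ b) W x y|)]) => [|nex].
  case/existsP=> x /andP[xD /existsP[y /andP[yD /andP[nxy lt]]]].
  by exists x, y.
pose S := [set z in s | has (fun x => hue b x z) D].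
have free z x y : x \in D -> y \in D -> z \in s -> hue b x z -> ~~ hue b y (next s z).
  move=> xD yD zs xz; apply/negP => ynz; have [exy|nxy] := eqVneq x y.
    by have := insertableN (not_insertable no1 (off _ xD)) zs xz; rewrite exy ynz.
  apply: no2; have := @insert_path b s Us Cs z x [:: y] zs; rewrite addn2; apply=> //=.
  - by rewrite inE nxy.
  - by move=> z'; rewrite !inE => /orP[] /eqP->; apply: off.
  - by rewrite hueC xz (cl _ _ xD yD).
have Ss : {subset S <= s} by move=> z; rewrite inE => /andP[].
have leS : 2 * #|S| <= size s.
  rewrite -[size s]addn0; apply: (adjacent_bound Us Ss).
  rewrite leqn0 cards_eq0 -subset0; apply/subsetP => z; rewrite !inE.
  case/andP=> /andP[zs /hasP[x xD xz]] /andP[_ /hasP[y yD]].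
  by rewrite (negPf (free z x y xD yD zs xz)).
have reachS x y : x \in D -> y \in D -> x != y -> touched b s x y = S.
  move=> xD yD nxy; apply/eqP; rewrite eqEcard; apply/andP; split.
    apply/subsetP => z; rewrite 2!inE => /andP[-> xyz]; rewrite andTb; apply/hasP.
    by case/orP: xyz => ?; [exists x | exists y].
  have := card_reach b Us x y; rewrite -/W.
  suff : 2 * #|common (~~ b) W x y| <= size s by move: leS; arith.
  rewrite leqNgt; apply: contraNN nex => lt; apply/existsP; exists x; rewrite xD.
  by apply/existsP; exists y; rewrite yD nxy.
have [uD vD wD] : [/\ u \in D, v \in D & w \in D] by rewrite !inE !eqxx ?orbT.
have [nuv nuw nvw] : [/\ u != v, u != w & v != w].
  by move: Uuvw; rewrite /= !inE negb_or andbT => /andP[/andP[]].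
have geS : size s <= 2 * #|S|.
  have := card_reach b Us u v; rewrite -/W (reachS u v) //.
  have : ~~ (size s < 2 * #|common (~~ b) W u v|).
    apply: contraNN nex => lt; apply/existsP; exists u; rewrite uD.
    by apply/existsP; exists v; rewrite vD nuv.
  by rewrite -leqNgt; arith.
have inj_next : injective (next s) := can_inj (prev_next Us).
have free1 z : z \in S -> next s z \notin S.
  rewrite inE => /andP[zs /hasP[x xD xz]]; rewrite inE negb_and mem_next zs orFb.
  by apply/hasPn => y yD; apply: free xz.
have shift : next s @: S = W :\: S.
  apply/eqP; rewrite eqEcard; apply/andP; split.
    by apply/subsetP => _ /imsetP[z zS ->]; rewrite in_setD free1 // inE mem_next Ss.
  rewrite card_imset //; have := cardsID S W; rewrite (card_set_seq Us).
  have -> : W :&: S = S by apply/setIidPr/subsetP => z /Ss; rewrite inE.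
  by move: leS geS; arith.
have [z zS] : exists z, z \in S by apply/set0Pn; rewrite -card_gt0; move: ls geS; arith.
have z2S : next s (next s z) \in S.
  apply/negPn/negP => z2; have : next s (next s z) \in W :\: S.
    by rewrite inE z2 inE !mem_next Ss.
  rewrite -shift => /imsetP[z' z'S /inj_next nz].
  by have := free1 _ zS; rewrite nz z'S.
have [zs /hasP[x xD xz]] : z \in s /\ has (fun x => hue b x z) D.
  by move: zS; rewrite inE => /andP[].
have [p [q [pD qD [nxp nxq npq]]]] : exists p q, [/\ p \in D, q \in D &
    [/\ x != p, x != q & p != q]].
  move: xD; rewrite !inE => /or3P[] /eqP->; [exists v, w | exists u, w | exists u, v];
  by split=> //; split=> //; rewrite eq_sym.
have [y [yD nxy yz]] : exists y, [/\ y \in D, x != y & hue b y (next s (next s z))].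
  move: z2S; rewrite -(reachS p q) // inE => /andP[_ /orP[pz|qz]].
    by exists p.
  by exists q.
case: no1; apply: (@insert_skip b s Us Cs z x y) => //.
- exact: off.
- exact: off.
- by rewrite hueC.
- exact: cl.
Qed.

End OffCycle.

(** * Even cycles *)

Section EvenCycles.

Lemma card_off (s : seq V) : uniq s -> #|~: [set x in s]| + size s = #|V|.
Proof. by move=> Us; rewrite -(card_set_seq Us) addnC cardsC. Qed.

(** All pairs off the cycle have at least [k - 1] common neighbours in the other
    colour, and [k] links are needed. One pair with [k] common neighbours would
    suffice ([small]). So would a vertex [c] common to [u, v] but not to [u, w]
    ([nest]): with [c] linking [u, v] and the pair [w, u] closing the cycle, [c]
    does not count among the vertices lost for that last pair. *)
Lemma mono_even_of_pred k :
  2 < k -> 3 * k <= #|V| + 1 -> mono_cycle (2 * k - 1) -> mono_cycle (2 * k).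
Proof.
move=> k3 leV [b [s [Us szs Cs]]]; case: (mono_dec (2 * k)) => // noL; exfalso.
pose W := [set x in s]; pose J := ~: W.
have szS : (size s).+1 = 2 * k by move: szs; arith.
have no1 : ~ mono_cycle (size s).+1 by rewrite szS.
have no2 : ~ mono_cycle (size s).+2 by rewrite szS; apply: mono_pred.
have offJ : {in J, forall z, z \notin s} by move=> z; rewrite !inE.
have offW : {in J, forall z, z \notin W} by move=> z; rewrite !inE.
have insJ : {in J, forall z, ~~ insertable b s z}.
  by move=> z /offJ; apply: not_insertable.
have leJ : k <= #|J| by have := card_off Us; rewrite -/W -/J; arith.
have big : {in J &, forall u v, u != v -> k - 1 <= #|common (~~ b) W u v|}.
  move=> u v uJ vJ nuv.
  have := common_cross Us Cs no2 (offJ _ uJ) (offJ _ vJ) nuv (insJ _ uJ) (insJ _ vJ).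
  by rewrite -/W; arith.
have small : {in J &, forall u v, u != v -> #|common (~~ b) W u v| < k}.
  move=> u v uJ vJ nuv; rewrite ltnNge; apply/negP => gek; apply: noL.
  apply: (@weave_last (~~ b) W J offW (k - 2) v [::] u) => //=.
  - by move=> x y xJ yJ nxy; have := big _ _ xJ yJ nxy; arith.
  - by rewrite inE eq_sym nuv.
  - by apply/allP; rewrite /= uJ vJ.
  - by arith.
  - by arith.
  - by arith.
have nest u v w : u \in J -> v \in J -> w \in J -> uniq [:: u; v; w] ->
    common (~~ b) W u v \subset common (~~ b) W u w.
  move=> uJ vJ wJ Uuvw; apply/subsetPn => -[c cuv cuw]; apply: noL.
  have [nuv nuw nvw] : [/\ u != v, u != w & v != w].
    by move: Uuvw; rewrite /= !inE negb_or andbT => /andP[/andP[]].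
  have sJ : {subset [:: u; v; w] <= J} by apply/allP; rewrite /= uJ vJ wJ.
  have [|q [szq Uq qJ]] := @extend_uniq _ J [:: u; v; w] (k - 3) Uuvw sJ.
    by rewrite /=; arith.
  have pE : perm_eq (u :: [:: c; v] ++ rcons q w) (c :: [:: u; v; w] ++ q).
    apply/permP => a; rewrite /= -cats1 count_cat /= addn0.
    by rewrite addnCA (addnC (count a q)).
  have cW : c \in W by move: cuv; rewrite inE => /andP[].
  (* The link [c] is made part of the direct path [u, c, v], and is removed
     from the pool of links. *)
  have commonD x y : #|common (~~ b) W x y| =
      (c \in common (~~ b) W x y) + #|common (~~ b) (W :\ c) x y|.
    rewrite (cardsD1 c); congr (_ + _); apply: eq_card => z.
    by rewrite !inE; case: (z == c); rewrite ?andbF.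
  have [|||||s' [Us' szs' Cs']] := @weave_cycle (~~ b) (W :\ c) u [:: c; v] (rcons q w).
  - rewrite (perm_uniq pE) cons_uniq Uq andbT mem_cat; apply/negP => cq.
    have : c \in J by case/orP: cq => [/sJ|/qJ].
    by rewrite inE cW.
  - move=> z; rewrite (perm_mem pE) in_cons => /predU1P[->|zJ]; first by rewrite !inE eqxx.
    rewrite in_setD1 negb_and; apply/orP; right; apply: offW.
    by move: zJ; rewrite mem_cat => /orP[/sJ|/qJ].
  - by move: cuv; rewrite inE => /and3P[_ /= -> vc]; rewrite hueC vc.
  - rewrite size_rcons szq; apply: (@uniq_path_in _ (mem J)).
    + move=> x y xJ yJ nxy; have := big _ _ xJ yJ nxy; rewrite commonD.
      by case: (c \in _); arith.
    + have : uniq (u :: v :: w :: q) := Uq.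
      by rewrite /= rcons_uniq mem_rcons !inE => /and4P[_ -> -> ->].
    + apply/allP; rewrite /= all_rcons vJ wJ; exact/allP.
  - rewrite size_rcons szq last_cat last_rcons.
    have := big _ _ wJ uJ; rewrite eq_sym commonD (commonC _ _ w) (negPf cuw).
    by move=> /(_ nuw); arith.
  by exists (~~ b), s'; split=> //; rewrite szs' /= size_rcons szq; arith.
have another (D : seq V) : size D < 3 -> exists2 v, v \in J & v \notin D.
  move=> ltD; have /set0Pn[v] : J :\: [set x in D] != set0.
    rewrite -card_gt0; have := cardsID [set x in D] J.
    have := subset_leq_card (subsetIr J [set x in D]).
    have : #|[set x in D]| <= size D by rewrite cardsE card_size.
    by move: leJ k3 ltD; arith.
  by rewrite in_setD inE => /andP[vD vJ]; exists v.
(* [f u] exists because [u] has at least [k] neighbours in the other colour, more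
   than it shares with any [v]; by [nest] all these shares are the same. *)
pose P u c := [/\ c \in s, hue (~~ b) u c & {in J, forall v, u != v -> hue b v c}].
have [f fP] : exists f : V -> V, forall u, u \in J -> P u (f u).
  apply: (@fin_all_exists V (fun=> V) (fun u c => u \in J -> P u c)) => u.
  case: (boolP (u \in J)) => uJ; last by exists u.
  have [//|v vJ] := another [:: u]; rewrite inE => nvu.
  have : #|common (~~ b) W u v| < #|common (~~ b) W u u|.
    rewrite eq_sym in nvu; have := small _ _ uJ vJ nvu.
    by have := common_self Us (insJ _ uJ); rewrite -/W; move: szS; arith.
  rewrite ltnNge; move/(contraNN (@subset_leq_card _ _ _))/subsetPn=> [c].
  rewrite inE andbb => /andP[cW uc] cuv; exists c => _; split=> //.
    by rewrite inE in cW.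
  move=> w wJ nuw; rewrite -[b]negbK hueN; apply: contraNN cuv => wc.
  have [<-|nwv] := eqVneq w v; first by rewrite inE cW uc wc.
  apply: (subsetP (nest u w v uJ wJ vJ _)); last by rewrite inE cW uc wc.
  by rewrite /= !inE negb_or nuw (eq_sym u) nvu nwv.
have inj_f : {in J &, injective f}.
  move=> u v uJ vJ efuv; apply/eqP; case: eqVneq => // nuv.
  have [_ _ /(_ v vJ nuv)] := fP _ uJ; have [_ + _] := fP _ vJ.
  by rewrite -efuv hueN => /negPf->.
have fJs : {subset f @: J <= s} by move=> _ /imsetP[u /fP[fus _ _] ->].
(* If [f u] and [f v] were consecutive, a third vertex could be inserted there. *)
have : 2 * #|f @: J| <= size s + 0.
  apply: adjacent_bound => //; rewrite leqn0 cards_eq0 -subset0.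
  apply/subsetP => x; rewrite inE => /andP[/imsetP[u uJ ->] /imsetP[v vJ nxt]].
  have [//|w wJ] := another [:: u; v]; rewrite !inE negb_or => /andP[nwu nwv].
  have [fus _ /(_ w wJ)] := fP _ uJ; have [_ _ /(_ w wJ)] := fP _ vJ.
  rewrite eq_sym nwv eq_sym nwu -nxt => /(_ isT) wn /(_ isT) wf.
  by have := insertableN (insJ _ wJ) fus wf; rewrite wn.
by rewrite card_in_imset //; move: leJ szS; arith.
Qed.

Lemma mono_even_step k :
  2 < k -> 3 * k <= #|V| + 1 -> mono_cycle (2 * k - 2) -> mono_cycle (2 * k).
Proof.
move=> k3 leV [b [s [Us szs Cs]]]; case: (mono_dec (2 * k)) => // noL.
case: (mono_dec (2 * k - 1)) => [|no1]; first exact: mono_even_of_pred.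
pose W := [set x in s]; pose J := ~: W; exfalso.
have [t tE] : exists t, k = t + 2 by exists (k - 2); arith.
have no1s : ~ mono_cycle (size s).+1 by move: no1; rewrite szs tE; congr (~ mono_cycle _); arith.
have no2s : ~ mono_cycle (size s).+2 by move: noL; rewrite szs tE; congr (~ mono_cycle _); arith.
have no1t : ~ mono_cycle (2 * t + 3) by move: no1; rewrite tE; congr (~ mono_cycle _); arith.
have offJ : {in J, forall z, z \notin s} by move=> z; rewrite !inE.
have offW : {in J, forall z, z \notin W} by move=> z; rewrite !inE.
have insJ : {in J, forall z, ~~ insertable b s z}.
  by move=> z /offJ; apply: not_insertable.
have leJ : k + 1 <= #|J| by have := card_off Us; rewrite -/W -/J; arith.
have [|||c cJ] := off_cycle_hue Us Cs offJ insJ no2s no1t; try by arith.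
have [cE|cE] : c = ~~ b \/ c = b by case: (c); case: (b); [right|left|left|right].
  apply: no1t; apply: (@weave_clique b s t J) => //; last by rewrite -cE.
  - by arith.
  - by arith.
  move=> u v uJ vJ nuv; have := common_cross Us Cs no2s (offJ _ uJ) (offJ _ vJ) nuv.
  by move/(_ (insJ _ uJ) (insJ _ vJ)); rewrite -/W; arith.
have big : {in J &, forall u v, u != v -> k - 1 <= #|common (~~ b) W u v|}.
  move=> u v uJ vJ nuv; have := common_joined Us Cs no2s (offJ _ uJ) (offJ _ vJ) nuv.
  move/(_ (insJ _ uJ) (insJ _ vJ)); rewrite -{1}cE cJ // => /(_ isT).
  by rewrite -/W; arith.
have [//|//||D [szD UD DJ]] := @extend_uniq V J [::] 3; first by rewrite /=; arith.
case: D szD UD DJ => [|u [|v [|w []]]] // _ UD DJ.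
have [|||x [y [xD yD nxy lt]]] := three_joined Us Cs UD _ _ _ no1s no2s.
- by move=> z /DJ/offJ.
- by move=> x y /DJ xJ /DJ yJ; rewrite -cE; apply: cJ.
- by arith.
apply: noL; apply: (@weave_last (~~ b) W J offW (k - 2) x [::] y) => //=.
- by move=> z z' zJ z'J nzz; have := big _ _ zJ z'J nzz; arith.
- by rewrite inE nxy.
- by apply/allP; rewrite /= !DJ.
- by rewrite commonC; move: lt; rewrite -/W; arith.
- by arith.
- by arith.
Qed.

Lemma mono_even k : 1 < k -> 6 <= #|V| -> 3 * k <= #|V| + 1 -> mono_cycle (2 * k).
Proof.
move=> + V6; elim: k => // k IHk; rewrite ltnS leq_eqVlt => /predU1P[<- _|k1 leV].
  exact: mono_quadrilateral.
apply: mono_even_step => //; have -> : 2 * k.+1 - 2 = 2 * k by arith.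
by apply: IHk => //; move: leV; arith.
Qed.

End EvenCycles.

(** * Odd cycles *)

Section OddCycles.

Lemma clique_cycle c (A : {set V}) m :
  {in A &, forall u v, u != v -> hue c u v} -> 1 < m -> m <= #|A| -> mono_cycle m.
Proof.
move=> cA m1 leA; have [//|//|//|p [szp Up pA]] := @extend_uniq V A [::] m.
exists c, p; split=> //; case: p szp Up pA => [|x p] szp Up pA //.
rewrite /= rcons_path (@uniq_path_in _ (mem A)) //=.
apply: cA; try by apply: pA; rewrite ?mem_head ?mem_last.
case: p szp Up {pA} => [|y p] szp; first by move: m1; rewrite -szp.
by case/andP=> xyp _; apply: contraNneq xyp => /= e; rewrite -{1}e mem_last.
Qed.

(** Edges between [A] and [B] of which no two are disjoint all pass through one
    vertex [c]. *)
Lemma star (R : rel V) (A B : {set V}) :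
  (forall u v y z, u \in A -> v \in A -> y \in B -> z \in B ->
     R u y -> R v z -> u = v \/ y = z) -> 0 < #|V| ->
  exists c, forall u y, u \in A -> y \in B -> u != c -> y != c -> ~~ R u y.
Proof.
move=> meet V_gt0; case: (pickP (fun p : V * V => [&& p.1 \in A, p.2 \in B & R p.1 p.2])).
  case=> u y /and3P[/= uA yB uy].
  case: (boolP [exists v in A, exists z in B, (v != u) && R v z]) => [|nex].
    case/existsP=> v /andP[vA /existsP[z /and3P[zB nvu vz]]].
    have ezy : z = y.
      by case: (meet v u z y) => // e; rewrite e eqxx in nvu.
    exists y => w x wA xB nwy nxy; apply/negP => wx.
    case: (meet w u x y) => // ew; last by rewrite ew eqxx in nxy.
    case: (meet w v x z) => // e; last by rewrite e ezy eqxx in nxy.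
    by rewrite -e ew eqxx in nvu.
  exists u => v z vA zB nvu _; apply: contraNN nex => vz.
  by apply/existsP; exists v; rewrite vA; apply/existsP; exists z; rewrite zB nvu.
move=> none; have /card_gt0P[c _] := V_gt0; exists c => u y uA yB _ _.
by have := none (u, y); rewrite /= uA yB /= => ->.
Qed.

(** The insertable vertices [I] all fit into a single edge [x0 x1] of the cycle,
    so they form a clique of the other colour, and the same lower bound on common
    neighbours holds in [I] and in [J]. If [I] is large, it carries the cycle by
    [weave_clique]. Otherwise [J] has enough vertices to be of a single colour
    ([hueJ]). Two disjoint edges [u y], [v z] of the other colour between [I] and
    [J] give three direct edges [y, u, v, z], and the rest of the cycle is woven
    from [J]. If there are no such two edges, then deleting one vertex leaves
    [I'] and [J'] completely joined in colour [b]; either [x0 x1] together with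
    [J'], linked through [I'], or [J'] alone, with colour [b] inside and links
    in [I'], gives a cycle of colour [b]. *)
Lemma mono_odd_step t :
  0 < t -> 4 * t + 5 <= #|V| -> mono_cycle (2 * t + 1) -> mono_cycle (2 * t + 3).
Proof.
move=> t_gt0 leV [b [s [Us szs Cs]]]; case: (mono_dec (2 * t + 3)) => // noL.
exfalso; pose W := [set x in s].
have no2 : ~ mono_cycle (size s).+2 by move: noL; rewrite szs; congr (~ mono_cycle _); arith.
pose U := ~: W; pose I := [set u in U | insertable b s u]; pose J := U :\: I.
have sIU : {subset I <= U} by move=> u; rewrite inE => /andP[].
have sJU : {subset J <= U} by move=> u; rewrite inE => /andP[].
have offU : {in U, forall z, z \notin s} by move=> z; rewrite !inE.
have offI : {in I, forall z, z \notin s} by move=> z /sIU/offU.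
have offJ : {in J, forall z, z \notin s} by move=> z /sJU/offU.
have insJ : {in J, forall z, ~~ insertable b s z}.
  by move=> z; rewrite 2!inE => /andP[+ zU]; rewrite zU.
have offIJ u : u \in J -> u \notin I by rewrite inE => /andP[].
have cardIJ : 2 * t + 4 <= #|I| + #|J|.
  have := cardsID I U; have := card_off Us; rewrite -/W -/U -/J.
  have -> : U :&: I = I by apply/setIidPr/subsetP.
  by arith.
have bigJ : {in J &, forall u v, u != v -> t <= #|common (~~ b) W u v|}.
  move=> u v uJ vJ nuv.
  have := common_cross Us Cs no2 (offJ _ uJ) (offJ _ vJ) nuv (insJ _ uJ) (insJ _ vJ).
  by rewrite -/W; arith.
have hueJ : t + 2 <= #|J| -> exists c, {in J &, forall u v, u != v -> hue c u v}.
  by apply: (off_cycle_hue Us Cs offJ insJ no2 noL); arith.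
have hueJb c (A : {set V}) : A \subset J -> t + 3 <= #|A| ->
    {in J &, forall u v, u != v -> hue c u v} -> c = b.
  move=> /subsetP sA leA cJ; apply/eqP; case: eqVneq => // ncb; exfalso; apply: noL.
  apply: (@weave_clique b s t A) => //; first by move=> z /sA/offJ.
  - by move=> u v /sA uJ /sA vJ; apply: bigJ.
  - move=> u v /sA uJ /sA vJ; rewrite (_ : ~~ b = c); first exact: cJ.
    by case: (b) (c) ncb => [] [].
have [leI|I2] : #|I| <= 1 \/ 1 < #|I| by arith.
  have [|c cJ] := hueJ; first by move: leI cardIJ t_gt0; arith.
  apply: noL; apply: (clique_cycle cJ); arith.
have same : {in I &, forall u v, u != v -> {in s &, forall x y,
    hue b u x -> hue b u (next s x) -> hue b v y -> hue b v (next s y) -> x = y}}.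
  move=> u v uI vI nuv x y xs ys ux unx vy vny; apply/eqP; case: eqVneq => // nxy.
  by case: no2; apply: (@insert_two b s Us Cs x y u v); rewrite ?offI.
have [x0 [x0s x0I x0u]] : exists x0, [/\ x0 \in s,
    {in I, forall u, hue b u x0 /\ hue b u (next s x0)} &
    {in I, forall u, {in s, forall x, hue b u x -> hue b u (next s x) -> x = x0}}].
  have insI u : u \in I -> exists x, [/\ x \in s, hue b u x & hue b u (next s x)].
    by rewrite inE => /andP[_ /existsP[x /and3P[]]]; exists x.
  have /card_gt1P[u [v [uI vI nuv]]] := I2.
  have [x [xs ux unx]] := insI u uI; have [y [ys vy vny]] := insI v vI.
  have only : {in I, forall w, {in s, forall z, hue b w z -> hue b w (next s z) -> z = x}}.
    move=> w wI z zs wz wnz; have [ewu|nwu] := eqVneq w u.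
      rewrite (same u v uI vI nuv x y) //; rewrite ewu in wz wnz.
      exact: (same u v uI vI nuv).
    exact: (same w u).
  exists x; split=> // w wI; have [z [zs wz wnz]] := insI w wI.
  by rewrite -(only w wI z).
have cliqueI : {in I &, forall u v, u != v -> hue (~~ b) u v}.
  move=> u v uI vI nuv; rewrite hueN; apply/negP => uv; apply: no2.
  have := @insert_path b s Us Cs x0 u [:: v] x0s; rewrite addn2; apply=> //=.
  - by rewrite inE nuv.
  - by move=> z; rewrite !inE => /orP[] /eqP->; apply: offI.
  - by rewrite uv hueC; case: (x0I u uI) => ->.
  - by case: (x0I v vI).
have bigI : {in I &, forall u v, u != v -> t <= #|common (~~ b) W u v|}.
  move=> u v uI vI nuv.
  suff : size s <= 2 * #|common (~~ b) W u v| + 1 by rewrite szs; arith.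
  apply: common_bound => //; rewrite -(cards1 x0); apply: subset_leq_card.
  apply/subsetP => x; rewrite !inE mem_next => /andP[/andP[xs uvx] /andP[_ uvnx]].
  apply/eqP; case: (eqVneq x x0) => // nx; exfalso.
  have [ux0 unx0] := x0I u uI; have [vx0 vnx0] := x0I v vI.
  case/orP: uvx => wx; case/orP: uvnx => wnx.
  - by rewrite (x0u u uI x) ?eqxx in nx.
  - by apply: no2; apply: (@insert_cross b s Us Cs x x0 u v); rewrite ?offI.
  - by apply: no2; apply: (@insert_cross b s Us Cs x x0 v u); rewrite ?offI // eq_sym.
  - by rewrite (x0u v vI x) ?eqxx in nx.
have [geI|ltI] : t + 3 <= #|I| \/ #|I| <= t + 2 by arith.
  by apply: noL; apply: (@weave_clique b s t I).
have leJ : t + 2 <= #|J| by move: cardIJ; arith.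
have [c cJ] := hueJ leJ.
case: (boolP [exists u in I, exists v in I, exists y in J, exists z in J,
    [&& u != v, y != z, hue (~~ b) u y & hue (~~ b) v z]]) => [|nex].
  case/existsP=> u /andP[uI /existsP[v /andP[vI /existsP[y /andP[yJ]]]]].
  case/existsP=> z /and5P[zJ nuv nyz uy vz]; apply: noL.
  have Uyz : uniq [:: y; z] by rewrite /= inE nyz.
  have yzJ : {subset [:: y; z] <= J} by apply/allP; rewrite /= yJ zJ.
  have [|q [szq Uq qJ]] := @extend_uniq V J [:: y; z] (t - 1) Uyz yzJ.
    by rewrite /=; arith.
  have yzqJ : {subset [:: y; z] ++ q <= J}.
    by move=> w; rewrite mem_cat => /orP[/yzJ|/qJ].
  have pE : perm_eq (y :: [:: u; v; z] ++ q) ([:: u; v] ++ ([:: y; z] ++ q)).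
    by apply/permP => a /=; rewrite addnCA (addnCA (a y)).
  have [|||||s' [Us' szs' Cs']] := @weave_cycle (~~ b) W y [:: u; v; z] q.
  - rewrite (perm_uniq pE) cat_uniq Uq andbT; apply/andP; split.
      by rewrite /= inE nuv.
    apply/hasPn => w /yzqJ/offIJ wI; apply: contraNN wI => /=.
    by rewrite mem_seq2 => /orP[] /eqP->.
  - move=> w; rewrite (perm_mem pE) mem_cat => /orP[|/yzqJ/offJ]; last by rewrite inE.
    by rewrite mem_seq2 inE => /orP[] /eqP->; apply: offI.
  - by rewrite /= hueC uy cliqueI ?vz.
  - apply: (@uniq_path_in _ (mem J)).
    + by move=> w w' wJ w'J nww'; rewrite szq; have := bigJ _ _ wJ w'J nww'; arith.
    + by case/andP: Uq.
    + by move=> w wq; apply: yzqJ; rewrite inE wq orbT.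
  - have lJ : last z q \in z :: q := mem_last z q.
    rewrite szq /=; have : last z q != y.
      by case/andP: Uq => yzq _; apply: contraNneq yzq => <-.
    move=> nly; apply: (@leq_trans t); first by arith.
    by apply: bigJ nly; apply: yzqJ; rewrite ?mem_head // inE lJ orbT.
  by exists (~~ b), s'; split=> //; rewrite szs' szq /=; arith.
have [||d dIJ] := @star (hue (~~ b)) I J.
- move=> u v y z uI vI yJ zJ uy vz; case: (eqVneq u v) => [|nuv]; first by left.
  case: (eqVneq y z) => [|nyz]; first by right.
  case/negP: nex; apply/existsP; exists u; rewrite uI; apply/existsP; exists v.
  rewrite vI; apply/existsP; exists y; rewrite yJ; apply/existsP; exists z.
  by rewrite zJ nuv nyz uy vz.
- by arith.
pose I' := I :\ d; pose J' := J :\ d.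
have cardIJ' : 2 * t + 3 <= #|I'| + #|J'|.
  have := cardsD1 d I; have := cardsD1 d J; have := @offIJ d; rewrite -/I' -/J'.
  by case: (d \in J) => [/(_ isT)/negPf->|_]; case: (d \in I); move: cardIJ; arith.
have sI' : {subset I' <= I} by move=> u; rewrite inE => /andP[].
have sJ' : {subset J' <= J} by move=> u; rewrite inE => /andP[].
have joined : {in I' & J', forall u y, hue b u y}.
  move=> u y; rewrite in_setD1 => /andP[nud uI]; rewrite in_setD1 => /andP[nyd yJ].
  by have := dIJ u y uI yJ nud nyd; rewrite hueN negbK.
have commonI' y z : {in I', forall u, hue b u y /\ hue b u z} -> common b I' y z = I'.
  move=> yz; apply/setP => u; rewrite inE; case: (boolP (u \in I')) => // /yz[uy uz].
  by rewrite hueC uy hueC uz.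
(* With [t + 1] links in [I'], the vertices [x0], [x1] and [t] vertices of [J']
   suffice, the edge [x0 x1] making the length odd. *)
have [geI'|ltI'] : t < #|I'| \/ #|I'| <= t by arith.
  pose x1 := next s x0; pose J2 := x0 |: (x1 |: J').
  have nx : x1 != x0 by apply: next_neq => //; rewrite szs; arith.
  have x1s : x1 \in s by rewrite mem_next.
  have J2P z : z \in J2 -> z \notin I' /\ {in I', forall u, hue b u z}.
    rewrite !in_setU1 => /or3P[/eqP->|/eqP->|zJ]; split.
    - by apply/negP => /sI'/offI; rewrite x0s.
    - by move=> u /sI'/x0I[].
    - by apply/negP => /sI'/offI; rewrite x1s.
    - by move=> u /sI'/x0I[].
    - by apply: contraNN (offIJ _ (sJ' _ zJ)) => /sI'.
    - by move=> u uI; apply: joined.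
  apply: noL; apply: (@weave_any b I' J2 _ t x0 [:: x1]) => //=.
  - by move=> z /J2P[].
  - by move=> y z /J2P[_ yI] /J2P[_ zI] _; rewrite commonI' // => u uI; rewrite yI ?zI.
  - by rewrite inE eq_sym nx.
  - by apply/allP; rewrite /= !in_setU1 !eqxx orbT.
  - by rewrite next_cycle.
  - rewrite !cardsU1 !in_setU1 eq_sym (negPf nx) /=.
    have -> : x0 \notin J' by apply/negP => /sJ'/offJ; rewrite x0s.
    have -> : x1 \notin J' by apply/negP => /sJ'/offJ; rewrite x1s.
    by have := cardsD1 d J; rewrite -/J'; case: (d \in J); move: leJ; arith.
  - by arith.
have cb : c = b.
  apply: (hueJb c J') cJ; first by apply/subsetP.
  by move: cardIJ' ltI'; arith.
have bJ' : {in J' &, forall u v, u != v -> hue b u v}.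
  by move=> u v /sJ' uJ /sJ' vJ; rewrite -cb; apply: cJ.
apply: noL; have [I'0|I'_gt0] := posnP #|I'|.
  by apply: (clique_cycle bJ'); move: cardIJ'; rewrite ?I'0; arith.
have [//|//||p [szp Up pJ']] := @extend_uniq V J' [::] (2 * t + 4 - 2 * #|I'|).
  by rewrite /=; move: cardIJ' ltI'; arith.
case: p szp Up pJ' => [|x p] /= szp Up pJ'; first by move: szp ltI'; arith.
apply: (@weave_any b I' J' _ (#|I'| - 1) x p) => //.
- by move=> z /sJ'/offIJ; apply: contraNN => /sI'.
- move=> u v uJ' vJ' nuv; rewrite commonI'; first by arith.
  by move=> w wI'; rewrite !joined.
- exact: (@uniq_path_in _ (mem J')).
- by move: szp ltI'; arith.
- by move: szp cardIJ' ltI'; arith.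
- by move: szp ltI'; arith.
Qed.

Lemma mono_odd k : 1 < k -> 6 <= #|V| -> 4 * k <= #|V| + 3 -> mono_cycle (2 * k - 1).
Proof.
move=> + V6; elim: k => // k IHk; rewrite ltnS leq_eqVlt => /predU1P[<- _|k1 leV].
  exact: mono_triangle.
have -> : 2 * k.+1 - 1 = 2 * (k - 1) + 3 by arith.
apply: mono_odd_step; try by arith.
have -> : 2 * (k - 1) + 1 = 2 * k - 1 by arith.
by apply: IHk => //; move: leV; arith.
Qed.

End OddCycles.

End TwoColourings.
(** * Polychromatic colourings *)

Lemma cycle_allE (T : eqType) (e : rel T) s :
  uniq s -> cycle e s = all (fun x => e x (next s x)) s.
Proof.
move=> Us; apply/idP/allP => [Cs x|es]; first exact: next_cycle.
apply: (@sub_in_cycle _ (mem s) (frel (next s)) e) (cycle_next Us); last exact/allP.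
by move=> x y xs _ /eqP <-; apply: es.
Qed.

Lemma size_ord_seq n (s : seq 'I_n) l h :
  uniq s -> {in s, forall x : 'I_n, l <= x < h} -> size s <= h - l.
Proof.
move=> Us lh; rewrite -(size_iota l (h - l)) -(size_map (@nat_of_ord n)).
apply: uniq_leq_size.
  by rewrite map_inj_uniq //; apply: val_inj.
by move=> _ /mapP[x /lh hx ->]; rewrite mem_iota; lia.
Qed.

Section Colourings.

Variable n : nat.
Implicit Type c : {ffun edge n -> 'I_2}.

(** A colouring of the edges as a symmetric relation on the vertices; the default
    value is met only on the diagonal, where [[set x; y]] is not an edge. *)
Definition pair_colour c (x y : 'I_n) : bool :=
  if insub [set x; y] is Some e then c e == ord0 else false.

Lemma pair_colourC c : symmetric (pair_colour c).
Proof. by move=> x y; rewrite /pair_colour setUC. Qed.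

Lemma pair_colourE c (e : edge n) x y :
  val e = [set x; y] -> pair_colour c x y = (c e == ord0).
Proof. by rewrite /pair_colour => <-; rewrite valK. Qed.

(** A cycle misses one of two colours iff it is monochromatic in the other one.
    Both colours are present as soon as one cycle of the family exists, which
    the bound on [n - q] ensures. *)
Lemma polychromaticP q c : 3 <= n - q ->
  polychromatic (@C_family q n) c <-> ~ mono_cycle (pair_colour c) (n - q).
Proof.
move=> m3; split=> [[_ polyc] [b [s [Us szs Cs]]]|nomono].
  have famE : @C_family q n (cycle_edges s) by exists s.
  have [e] := polyc _ famE (if b then ord_max else ord0).
  rewrite inE => /existsP[x /andP[xs /eqP ve]] ce.
  have := next_cycle Cs xs; rewrite /hue (pair_colourE c ve) ce.
  by case: (b).
have polyc E : @C_family q n E -> forall i, exists2 e : edge n, e \in E & c e = i.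
  case=> s [Us szs _ ->] i.
  case: (boolP [exists e in cycle_edges s, c e == i]) => [|nex].
    by case/existsP=> e /andP[eE /eqP ce]; exists e.
  case: nomono; exists (i != ord0), s; split=> //; rewrite cycle_allE //.
  apply/allP => x xs.
  have card_e : #|[set x; next s x]| == 2.
    by rewrite cards2 (eq_sym x) next_neq // szs; lia.
  pose e : edge n := exist _ [set x; next s x] card_e.
  rewrite /hue (@pair_colourE c e) //.
  have : c e != i.
    apply: contraNN nex => ce; apply/existsP; exists e.
    by rewrite ce andbT inE; apply/existsP; exists x; rewrite xs /=.
  by move: (c _) i {nex} => [[|[|]]] // ? [[|[|]]].
split=> // i.
have famE : @C_family q n (cycle_edges (take (n - q) (enum 'I_n))).
  exists (take (n - q) (enum 'I_n)); split=> //.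
    by rewrite take_uniq ?enum_uniq.
  by rewrite size_takel // size_enum_ord leq_subr.
by have [e _ ce] := polyc _ famE i; exists e.
Qed.

Lemma exists_polychromatic q : 3 <= n - q ->
  (exists c, polychromatic (@C_family q n) c) <->
  exists2 col : 'I_n -> 'I_n -> bool, symmetric col & ~ mono_cycle col (n - q).
Proof.
move=> m3; split=> [[c /(polychromaticP _ m3) nomono]|[col colC nomono]].
  by exists (pair_colour c) => //; apply: pair_colourC.
pose joins (e : {set 'I_n}) :=
  [exists x in e, exists y in e, (x != y) && col x y].
pose c : {ffun edge n -> 'I_2} :=
  [ffun e : edge n => if joins (val e) then ord0 else ord_max].
exists c; apply/(polychromaticP _ m3) => -[b [s [Us szs Cs]]]; apply: nomono.
exists b, s; split=> //; move: Cs; rewrite !cycle_allE // => /allP Cs.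
apply/allP => x xs; move/(_ x xs): Cs; rewrite /hue.
have nx : x != next s x by rewrite eq_sym next_neq // szs; lia.
have card_e : #|[set x; next s x]| == 2 by rewrite cards2 nx.
rewrite (@pair_colourE c (exist _ [set x; next s x] card_e)) //.
rewrite ffunE /=; suff -> : joins [set x; next s x] = col x (next s x).
  by case: (col _ _).
apply/existsP/idP => [[y /andP[ye /existsP[z /and3P[ze nyz]]]]|cx].
  by move: ye ze nyz; rewrite !inE => /orP[] /eqP-> /orP[] /eqP->; rewrite ?eqxx // colC.
exists x; rewrite !inE eqxx; apply/existsP; exists (next s x).
by rewrite !inE eqxx orbT nx.
Qed.

(** * Colourings without monochromatic cycles of the given length *)

Definition lower a (s : seq 'I_n) : {set 'I_n} := [set x in s | x < a].

Definition upper a (s : seq 'I_n) : {set 'I_n} := [set x in s | a <= x].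

Lemma in_lower a s x : (x \in lower a s) = (x \in s) && (x < a).
Proof. by rewrite inE. Qed.

Lemma in_upper a s x : (x \in upper a s) = (x \in s) && (a <= x).
Proof. by rewrite inE. Qed.

Lemma half_side (s : seq 'I_n) (S : {set 'I_n}) : uniq s -> {subset S <= s} ->
  {in S, forall x, next s x \notin S} -> 2 * #|S| <= size s.
Proof.
move=> Us Ss free; rewrite -[size s]addn0; apply: adjacent_bound => //.
rewrite leqn0 cards_eq0 -subset0; apply/subsetP => x; rewrite inE.
by case/andP=> /free/negPf->.
Qed.

Lemma card_side (s : seq 'I_n) a : uniq s ->
  #|lower a s| + #|upper a s| = size s.
Proof.
move=> Us; rewrite -(card_set_seq Us) -(cardsID [set x : 'I_n | x < a] [set x in s]).
by congr (_ + _); apply: eq_card => x; rewrite !inE // -leqNgt andbC.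
Qed.

(** Along a cycle of the first colour no two consecutive vertices are below
    [n - q - 1], so at least half of it lies among the last [q + 1] vertices; a
    cycle of the second colour stays among the first [n - q - 1]. *)
Lemma no_mono_hub q : 3 * q + 3 <= n ->
  ~ mono_cycle (fun x y : 'I_n => (n - q.+1 <= x) || (n - q.+1 <= y)) (n - q).
Proof.
move=> len [b [s [Us szs]]]; rewrite cycle_allE // => /allP; rewrite /hue.
set a := n - q.+1; case: b => Cs.
  have : 2 * #|lower a s| <= size s.
    apply: half_side => // x; rewrite in_lower => /andP[xs ltx] //.
    rewrite in_lower mem_next xs -leqNgt; have := Cs x xs.
    by rewrite leqNgt ltx => /eqP.
  have : #|upper a s| <= n - a.
    rewrite cardE; apply: size_ord_seq (enum_uniq _) _ => x.
    by rewrite mem_enum in_upper ltn_ord andbT => /andP[].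
  by have := card_side a Us; rewrite szs; move: len; rewrite /a; lia.
have : size s <= a - 0.
  apply: size_ord_seq => // x xs; have := Cs x xs.
  by rewrite ltnNge; case: (a <= x).
by rewrite szs /a; lia.
Qed.

(** The first colour is bipartite. A cycle of the second colour stays on one
    side, and both sides have fewer than [n - q] vertices. *)
Lemma no_mono_bipartite q : odd (n - q) -> 2 * q + 2 <= n ->
  ~ mono_cycle (fun x y : 'I_n => (n - q.+1 <= x) (+) (n - q.+1 <= y)) (n - q).
Proof.
move=> oddm len [b [s [Us szs Cs]]]; set a := n - q.+1 in Cs.
case: b Cs => [|Cs].
  rewrite cycle_allE // => /allP; rewrite /hue => Cs.
  have : 2 * #|lower a s| <= size s.
    apply: half_side => // x; rewrite in_lower => /andP[xs ltx] //.
    rewrite in_lower mem_next xs -leqNgt; have := Cs x xs.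
    by rewrite leqNgt ltx => /eqP.
  have : 2 * #|upper a s| <= size s.
    apply: half_side => // x; rewrite in_upper => /andP[xs lex] //.
    rewrite in_upper mem_next xs; have := Cs x xs.
    by rewrite lex; case: (a <= next s x).
  by have := card_side a Us; rewrite szs; lia.
case: s Us szs Cs => [|x s] Us szs; first by move: oddm; rewrite -szs.
rewrite /= rcons_path => /andP[Cs _].
have side : {in x :: s, forall y : 'I_n, (a <= y) = (a <= x)}.
  move=> y; rewrite inE => /predU1P[-> //|ys].
  have tr : transitive (fun y z : 'I_n => (a <= y) == (a <= z)).
    by move=> u v w /eqP-> /eqP->.
  have Ps : path (fun y z : 'I_n => (a <= y) == (a <= z)) x s.
    apply: sub_path Cs => u v; rewrite /hue.
    by case: (a <= u); case: (a <= v).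
  by have /allP/(_ y ys)/eqP-> := order_path_min tr Ps.
case: (leqP a x) => [lex|ltx].
  have : size (x :: s) <= n - a.
    by apply: size_ord_seq => // y /side ->; rewrite lex ltn_ord.
  by rewrite szs /a; lia.
have : size (x :: s) <= a - 0.
  by apply: size_ord_seq => // y /side; rewrite ltnNge => ->; rewrite -ltnNge.
by rewrite szs /a; lia.
Qed.

End Colourings.

Theorem theorem2p5 (q n : nat) (hq : 2 <= q) (hn : 6 <= n) (hnq : q + 3 <= n) :
  (~~ odd (n - q) ->
     ((exists c : {ffun edge n -> 'I_2}, polychromatic (@C_family q n) c)
      <-> 3 * q + 3 <= n)) /\
  (odd (n - q) ->
     ((exists c : {ffun edge n -> 'I_2}, polychromatic (@C_family q n) c)
      <-> 2 * q + 2 <= n)).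
Proof.
have m3 : 3 <= n - q by lia.
have mE := odd_double_half (n - q).
split=> [evenm|oddm]; apply: (iff_trans (exists_polychromatic m3)).
  split=> [[col colC nomono]|len].
    rewrite leqNgt; apply/negP => ltn; apply: nomono.
    have -> : n - q = 2 * (n - q)./2 by rewrite -{1}mE (negPf evenm) mul2n.
    by apply: mono_even; rewrite ?card_ord //; lia.
  exists (fun x y : 'I_n => (n - q.+1 <= x) || (n - q.+1 <= y)).
    by move=> x y; rewrite orbC.
  exact: no_mono_hub.
split=> [[col colC nomono]|len].
  rewrite leqNgt; apply/negP => ltn; apply: nomono.
  have -> : n - q = 2 * (n - q)./2.+1 - 1 by rewrite -{1}mE oddm; lia.
  by apply: mono_odd; rewrite ?card_ord //; lia.
exists (fun x y : 'I_n => (n - q.+1 <= x) (+) (n - q.+1 <= y)).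
  by move=> x y; rewrite addbC.
exact: no_mono_bipartite.
Qed.
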